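(* For every fixed prime power $q$ and every integer $n \ge 2$, $$\chi_q(n) < \frac{2n}{q-1} + q.$$ Moreover, when $n \le \binom{q/2}{2} = \frac{(q/2)(q/2-1)}{2}$, we also have $$\chi_q(n) \le \sqrt{8n} + 4.$$
   Context: $\mathrm{PG}(n-1,q)$ denotes the $(n-1)$-dimensional projective space over the finite field $\mathbb{F}_q$, i.e. the points are the $1$-dimensional subspaces of $\mathbb{F}_q^n$ and the lines are the $2$-dimensional subspaces. The chromatic number $\chi_q(n)$ of $\mathrm{PG}(n-1,q)$ is the smallest number of colors needed to color the points of $\mathrm{PG}(n-1,q)$ so that no line has all of its points in a single color class. *)

(* Defs.v *)
From mathcomp Require Import all_boot all_order all_algebra.
From mathcomp Require Import boolp.

Set Implicit Arguments.
Unset Strict Implicit.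
Unset Printing Implicit Defensive.

Import Order.TTheory GRing.Theory Num.Theory.
Local Open Scope ring_scope.

Section ProjectiveSpace.
Variables (F : finFieldType) (n : nat).

(* PG(n-1, q) with q = #|F|; all dimensions below are vector space dimensions *)
Definition pg_point := {U : {vspace 'rV[F]_n} | \dim U == 1%N}.
Definition pg_line := {U : {vspace 'rV[F]_n} | \dim U == 2%N}.

Definition incident (P : pg_point) (L : pg_line) : bool :=
  (val P <= val L)%VS.

Definition monochromatic (C : Type) (c : pg_point -> C) (L : pg_line) : Prop :=
  exists i : C, forall P, incident P L -> c P = i.

Definition pg_colorable (k : nat) : Prop :=
  exists c : pg_point -> 'I_k, forall L, ~ monochromatic c L.

(* Giving the points pairwise distinct colors is a valid coloring, so that the
   minimum defining [pg_chi] exists. *)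
Lemma pg_colorable_ex : exists k, `[< pg_colorable k >].
Proof.
exists #|{: 'rV[F]_n}|; apply/asboolP.
exists (fun P => enum_rank (vpick (val P) : 'rV[F]_n)) => L [i monoL].
have dim_line v : v != 0 -> \dim <[v : 'rV[F]_n]>%VS == 1%N.
  by move=> v0; rewrite dim_vline v0.
pose pt v (v0 : v != 0) : pg_point := Sub <[v]>%VS (dim_line v v0).
have ptE v (v0 : v != 0) : v \in val L -> vpick <[v]> = enum_val i :> 'rV[F]_n.
  by move=> vL; rewrite -(monoL (pt v v0)) ?enum_rankK //=.
have sub : (val L <= <[enum_val i : 'rV[F]_n]>)%VS.
  apply/subvP => v vL; have [->|v0] := eqVneq v 0; first exact: mem0v.
  have := ptE v v0 vL => vE.
  have /vlineP[a aE] : vpick <[v]> \in <[v]>%VS by exact: memv_pick.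
  have a0 : a != 0.
    apply: contraTneq (v0) => a0; move: aE; rewrite a0 scale0r => /eqP.
    by rewrite vpick0 -dimv_eq0 dim_vline v0.
  by rewrite -vE aE; apply/vlineP; exists a^-1; rewrite scalerA mulVf ?scale1r.
have := dimvS sub; rewrite (eqP (valP L)) dim_vline.
by case: (_ != 0).
Qed.

Definition pg_chi : nat := ex_minn pg_colorable_ex.

End ProjectiveSpace.

(* Main.v *)
Require Import Defs.
From mathcomp Require Import all_boot all_order all_algebra.
From mathcomp Require Import boolp zify lra.

Import Order.TTheory GRing.Theory Num.Theory.
Local Open Scope ring_scope.

(* Cut the n coordinates into blocks of d, where 2d <= q, and scale v so that
   its leading coordinate, at position l of its block, is 1. If some later
   block b of v lies in W_l = {Y | Y_l != 0 and Y_r != Y_l ^ 2 for r != l},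
   then v gets the color V_b, and otherwise the color L_l; this takes
   d + (n - 1) %/ d colors.
   All points of a line except one (call it w) share their leading coordinate
   and read u + t w after scaling. The set W_l contains no affine line, because
   some Y_r would run through Y_l ^ 2 with Y_l fixed, or Y_l would run through
   0; this excludes a line of color V_b. But W_l meets every affine line along
   which Y_l varies, because at most 1 + 2(d - 1) < q values of t are bad; on a
   line of color L_l the leading coordinate of w has position l in a later
   block, so some u + t w has a color V_b after all.
   The bounds follow with d = q / 2 and with d = sqrt n, rounded. *)

(** * Leading coordinates and the parametrization of a line *)

Section LeadingCoordinate.
Context {F : fieldType} {n : nat}.
Implicit Types (v u w : 'rV[F]_n) (i : 'I_n).

Definition is_lead v i :=
  (v 0 i != 0) && [forall j : 'I_n, (j < i)%N ==> (v 0 j == 0)].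

Lemma is_leadP v i :
  reflect (v 0 i != 0 /\ forall j : 'I_n, (j < i)%N -> v 0 j = 0) (is_lead v i).
Proof.
apply: (iffP andP) => -[vi0 small]; split=> //.
  by move=> j ji; apply/eqP; move/forallP/(_ j)/implyP: small; apply.
by apply/forallP=> j; apply/implyP=> ji; rewrite small.
Qed.

Lemma lead_exists v : v != 0 -> exists i, is_lead v i.
Proof.
case/rV0Pn=> i0 vi0.
case: (@arg_minnP _ i0 (fun i => v 0 i != 0) (fun i => i : nat) vi0) => i vi imin.
exists i; apply/is_leadP; split=> // j ji; apply/eqP; apply: contraLR ji.
by rewrite -leqNgt; exact: imin.
Qed.

Lemma lead_unique v i j : is_lead v i -> is_lead v j -> i = j.
Proof.
case/is_leadP=> vi li; case/is_leadP=> vj lj; apply/val_inj.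
case: (ltngtP i j) => // ij; first by rewrite lj ?eqxx in vi.
by rewrite li ?eqxx in vj.
Qed.

Lemma is_leadZ v i a : a != 0 -> is_lead (a *: v) i = is_lead v i.
Proof.
move=> a0; rewrite /is_lead mxE mulf_eq0 (negPf a0) /=; congr (_ && _).
by apply: eq_forallb => j; rewrite mxE mulf_eq0 (negPf a0).
Qed.

Lemma is_lead_shift u w i t :
  is_lead u i -> (forall j : 'I_n, (j <= i)%N -> w 0 j = 0) ->
  is_lead (u + t *: w) i.
Proof.
case/is_leadP=> ui small w0; apply/is_leadP.
split=> [|j ji]; first by rewrite !mxE w0 ?mulr0 ?addr0.
by rewrite !mxE small ?w0 ?mulr0 ?addr0 // ltnW.
Qed.

(** Here [i] is the first coordinate that does not vanish on all of [L], and [u] is a basis vector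
    nonzero there. Any vector of [L] off the line of [u] becomes [w] once a multiple of [u] clears
    its coordinate [i]. *)
Lemma plane_parametrization (L : {vspace 'rV[F]_n}) : \dim L = 2%N ->
  exists u w i, [/\ u \in L, w \in L, w != 0, is_lead u i
                  & forall j : 'I_n, (j <= i)%N -> w 0 j = 0].
Proof.
move=> dimL; pose meets i := ~~ [forall k, (vbasis L)`_(k : 'I_(\dim L)) 0 i == 0].
have meetsP i v : v \in L -> ~~ meets i -> v 0 i = 0.
  move=> vL; rewrite negbK => /forallP Li0.
  rewrite (coord_vbasis vL) summxE big1 // => k _.
  by rewrite mxE (eqP (Li0 k)) mulr0.
have [v0 v0L v0N] : exists2 v, v \in L & v != 0.
  by exists (vpick L); rewrite ?memv_pick // vpick0 -dimv_eq0 dimL.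
have [i0 /is_leadP[vi0 _]] := lead_exists v0 v0N.
have Mi0 : meets i0 by apply: contraNT vi0 => /(meetsP _ _ v0L) ->.
case: (@arg_minnP _ i0 meets (fun i => i : nat) Mi0) => i Mi imin.
have small v (j : 'I_n) : v \in L -> (j < i)%N -> v 0 j = 0.
  move=> vL ji; apply: meetsP vL _; apply: contraL ji.
  by rewrite -leqNgt; exact: imin.
move: Mi; rewrite /meets negb_forall => /existsP[k uk].
set u := (vbasis L)`_k in uk.
have uL : u \in L by apply: vbasis_mem; rewrite mem_nth ?size_tuple.
have [x xL xu] : exists2 x, x \in L & x \notin <[u]>%VS.
  apply/subvPn; apply/negP => /dimvS; rewrite dimL dim_vline.
  by case: (_ != 0).
exists u, (x - (x 0 i / u 0 i) *: u), i; split=> //.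
- by rewrite memvB ?memvZ.
- by rewrite subr_eq0; apply: contra xu => /eqP ->; rewrite memvZ ?memv_line.
- by apply/is_leadP; split=> // j; exact: small.
move=> j; rewrite leq_eqVlt => /predU1P[/val_inj ->|ji].
  by rewrite !mxE divfK ?subrr.
by rewrite small ?memvB ?memvZ.
Qed.

End LeadingCoordinate.

(** * The block coloring and its lack of monochromatic lines *)

Section BlockColoring.
Context {F : finFieldType} {n : nat}.
Variable d : nat.
Implicit Types (v u w : 'rV[F]_n) (i k : 'I_n).

(* After normalising the leading coordinate [v 0 i] to 1, the last condition
   says that no other coordinate of the block of [k] equals the square of the
   [k]-th one. *)
Definition active v i k :=
  [&& (i %/ d < k %/ d)%N, (k %% d == i %% d)%N, v 0 k != 0 &
      [forall j : 'I_n, (j != k) && (j %/ d == k %/ d)%N ==>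
         (v 0 j * v 0 i != v 0 k ^+ 2)]].

(** An active [k] lies in a block of index at least 1, so the predecessor starts the block colors
    exactly at [d], just above the colors [i %% d]. *)
Definition block_color v : nat :=
  if [pick i | is_lead v i] is Some i then
    if [pick k | active v i k] is Some k then (d + k %/ d).-1 else (i %% d)%N
  else 0%N.

Lemma block_color_lead v i : is_lead v i ->
  block_color v =
    if [pick k | active v i k] is Some k then (d + k %/ d).-1 else (i %% d)%N.
Proof.
move=> vi; rewrite /block_color; case: pickP => [j vj|/(_ i)]; last by rewrite vi.
by rewrite (lead_unique _ _ _ vi vj).
Qed.

Lemma activeZ v i k a : a != 0 -> active (a *: v) i k = active v i k.
Proof.
move=> a0; rewrite /active !mxE mulf_eq0 (negPf a0) /=; congr [&& _, _, _ & _].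
apply: eq_forallb => j; rewrite !mxE mulrACA exprMn expr2.
by rewrite (inj_eq (mulfI (mulf_neq0 a0 a0))).
Qed.

Lemma block_colorZ v a : a != 0 -> block_color (a *: v) = block_color v.
Proof.
move=> a0; rewrite /block_color.
rewrite (eq_pick (fun i => is_leadZ v i a a0)); case: pickP => // i _.
by rewrite (eq_pick (fun k => activeZ v i k a a0)).
Qed.

Hypotheses (d_gt0 : (0 < d)%N) (n_gt0 : (0 < n)%N).

Lemma block_color_lt v : (block_color v < d + n.-1 %/ d)%N.
Proof.
rewrite /block_color; case: pickP => [i _|_]; last by rewrite ltn_addr.
case: pickP => [k /andP[ik _]|_]; last by rewrite ltn_addr ?ltn_mod.
have : (k %/ d <= n.-1 %/ d)%N by apply: leq_div2r; have := ltn_ord k; lia.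
by rewrite -(leq_add2l d) prednK // addn_gt0 d_gt0.
Qed.

Lemma block_card k :
  (#|[pred j : 'I_n | (j != k) && (j %/ d == k %/ d)%N]| < d)%N.
Proof.
pose pos (j : 'I_n) : 'I_d := Ordinal (ltn_pmod j d_gt0).
rewrite -[d in (_ < d)%N]card_ord; set A := [pred j | _].
have posI : {in [predU1 k & A] &, injective pos}.
  move=> x y; rewrite !inE => xA yA /(congr1 val) /= xy; apply/val_inj.
  have blockE (z : 'I_n) :
      (z == k) || (z != k) && (z %/ d == k %/ d)%N -> (z %/ d = k %/ d)%N.
    by case/orP=> [/eqP ->|/andP[_ /eqP]].
  by rewrite /= (divn_eq x d) (divn_eq y d) xy (blockE x xA) (blockE y yA).
have := max_card (mem (image pos [predU1 k & A])).
by rewrite card_in_image // cardU1 !inE eqxx.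
Qed.

Hypothesis d_small : (2 * d <= #|F|)%N.

(* The values of [t] for which [u + t w] is inactive at [k] are roots of a
   nonzero polynomial of degree at most 2d - 1. *)
Lemma active_on_line u w i k :
    w 0 i = 0 -> w 0 k != 0 ->
    (i %/ d < k %/ d)%N -> (k %% d = i %% d)%N ->
  exists t, active (u + t *: w) i k.
Proof.
move=> wi wk ik ikd.
pose X j : {poly F} := (w 0 j)%:P * 'X + (u 0 j)%:P.
pose A := [pred j : 'I_n | (j != k) && (j %/ d == k %/ d)%N].
pose Q j := X k ^+ 2 - (u 0 i)%:P * X j.
have XE j t : (X j).[t] = (u + t *: w) 0 j.
  by rewrite !mxE !hornerE addrC mulrC.
have sX j : (size (X j) <= 2)%N.
  rewrite size_MXaddC; case: ifP => // _.
  by rewrite size_polyC; case: (_ != 0).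
have sXk : size (X k) = 2%N.
  by rewrite size_MXaddC polyC_eq0 (negPf wk) size_polyC wk.
have Xk0 : X k != 0 by rewrite -size_poly_gt0 sXk.
have sQ j : size (Q j) = 3%N.
  have sXk2 : size (X k ^+ 2) = 3%N by rewrite expr2 size_mul // sXk.
  rewrite size_polyDl // sXk2 size_polyN ltnS.
  by rewrite mul_polyC (leq_trans (size_scale_leq _ _)).
have Q0 j : Q j != 0 by rewrite -size_poly_gt0 sQ.
pose P := X k * \prod_(j in A) Q j.
have P0 : P != 0.
  rewrite mulf_neq0 // prodf_seq_neq0.
  by apply/allP=> j _; rewrite Q0 implybT.
(* The degree is at most 1 + 2(d - 1), since the block of [k] has at most d - 1 other
   coordinates. *)
have sP : (size P <= #|F|)%N.
  apply: leq_trans (size_polyMleq _ _) _; rewrite sXk.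
  have := size_prod_leq (mem A) Q.
  rewrite (eq_bigr (fun=> 3%N)) => [|j _]; last exact: sQ.
  rewrite sum_nat_const; have := block_card k; rewrite -/A.
  set s := size _; set cA := #|A|; move: d_small; lia.
have [t Pt] : exists t, P.[t] != 0.
  apply/existsP; rewrite -[[exists _, _]]negbK negb_exists.
  apply/negP => /forallP Pz.
  have rootP : all (root P) (enum F).
    by apply/allP=> t _; have := Pz t; rewrite negbK.
  have := max_poly_roots P0 rootP (enum_uniq F).
  by rewrite -cardE ltnNge sP.
move: Pt; rewrite hornerM mulf_eq0 negb_or horner_prod => /andP[Xkt Qt].
exists t; rewrite /active ik ikd eqxx -XE Xkt; apply/forallP=> j; apply/implyP=> jA.
have : (Q j).[t] != 0.
  move: Qt; rewrite prodf_seq_neq0 => /allP/(_ j).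
  by rewrite mem_index_enum => /(_ isT)/implyP; apply.
rewrite hornerD hornerN horner_exp hornerM hornerC !XE !mxE wi.
by rewrite mulr0 addr0 subr_eq0 eq_sym [X in X != _]mulrC.
Qed.

Lemma affine_line_not_active u w i k k' :
    u 0 i != 0 -> w 0 i = 0 -> w 0 k' != 0 -> (k' %/ d = k %/ d)%N ->
  exists t, ~~ active (u + t *: w) i k.
Proof.
move=> ui wi wk' kk'; have [wk|wk] := eqVneq (w 0 k) 0; last first.
  exists (- u 0 k / w 0 k); rewrite /active !mxE divfK // subrr eqxx.
  by rewrite !andbF.
have k'k : k' != k by apply: contraNneq wk' => ->; rewrite wk.
(* Coordinate [k] is now constant on the affine line, and this [t] solves (u_k' + t w_k') u_i = u_k
   ^ 2. *)
exists ((u 0 k ^+ 2 / u 0 i - u 0 k') / w 0 k').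
rewrite /active !negb_and negb_forall; apply/orP; right; apply/orP; right.
apply/orP; right; apply/existsP; exists k'.
rewrite k'k kk' eqxx /= negbK !mxE divfK // wi wk !mulr0 !addr0.
by rewrite addrC subrK divfK.
Qed.

Lemma block_color_not_mono (L : {vspace 'rV[F]_n}) (c : nat) : \dim L = 2%N ->
  exists2 v, v \in L & (v != 0) && (block_color v != c).
Proof.
move=> dimL; have [u [w [i [uL wL w0 ulead wsmall]]]] := plane_parametrization L dimL.
have [|noex] := pselect (exists2 v, v \in L & (v != 0) && (block_color v != c)) => //.
have mono v : v \in L -> v != 0 -> block_color v = c.
  by move=> vL v0; apply/eqP; apply: contra_notT noex => vc; exists v; rewrite ?v0.
have [ui _] := is_leadP _ _ ulead; have wi := wsmall i (leqnn i).
have lead_t t := is_lead_shift u w i t ulead wsmall.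
have nz v j : is_lead v j -> v != 0.
  by case/is_leadP=> + _; apply: contraNneq => ->; rewrite mxE.
have cE t : block_color (u + t *: w) = c.
  by apply: mono (nz _ _ (lead_t t)); rewrite memvD ?memvZ.
have [i' wlead] := lead_exists w w0; have [wi' _] := is_leadP _ _ wlead.
have ii' : (i < i')%N.
  by rewrite ltnNge; apply: contraNN wi' => /wsmall ->.
have cw := mono w wL w0; rewrite (block_color_lead _ _ wlead) in cw.
case: pickP cw => [k' /and4P[ik' _ wk' _]|_] cw.
(* The color of [w] is a block color: every [u + t *: w] must then be active in the block of
   [k']. *)
- have k'0 := leq_ltn_trans (leq0n _) ik'.
  have dc : (d <= c)%N by rewrite -cw -(prednK k'0) addnS leq_addr.
  have act t : exists2 k, active (u + t *: w) i k & (k %/ d = k' %/ d)%N.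
    have := cE t; rewrite (block_color_lead _ _ (lead_t t)).
    case: pickP => [k kact ck|_ ci]; last first.
      by move: dc; rewrite -ci leqNgt ltn_pmod.
    exists k => //; move/and4P: kact => [ik _ _ _].
    have k0 := leq_ltn_trans (leq0n _) ik.
    move: ck; rewrite -cw -(prednK k'0) -(prednK k0) !addnS => /addnI.
    by move=> ->.
  have [k kact kk'] := act 0.
  have [t /negP[]] := affine_line_not_active u w i k k' ui wi wk' (esym kk').
  have [k2 k2act k2k'] := act t.
  (* An active coordinate is determined by its block and by its residue, which is that of [i]. *)
  suff -> : k = k2 by [].
  move: kact k2act => /and4P[_ /eqP ke _ _] /and4P[_ /eqP k2e _ _].
  by apply/val_inj; rewrite /= (divn_eq k d) (divn_eq k2 d) kk' k2k' ke k2e.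
(* The color of [w] is below [d], so no [u + t *: w] may have a block color. *)
- have inact t k : active (u + t *: w) i k = false.
    have := cE t; rewrite (block_color_lead _ _ (lead_t t)).
    case: pickP => [k1 /and4P[ik1 _ _ _] ck1|->] //.
    have k10 := leq_ltn_trans (leq0n _) ik1.
    have := ltn_pmod i' d_gt0; rewrite cw -ck1 -(prednK k10) addnS.
    by rewrite ltnNge leq_addr.
  have iE : (i' %% d = i %% d)%N.
    have := cE 0; rewrite (block_color_lead _ _ (lead_t 0)).
    by case: pickP => [k1|_ ->//]; rewrite inact.
  have ik : (i %/ d < i' %/ d)%N.
    rewrite ltnNge; apply/negP => i'i; move: ii'.
    by rewrite (divn_eq i d) (divn_eq i' d) iE ltn_add2r ltnNge leq_mul2r i'i orbT.
  have [t] := active_on_line u w i i' wi wi' ik iE.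
  by rewrite inact.
Qed.

Lemma pg_colorable_blocks : pg_colorable F n (d + n.-1 %/ d).
Proof.
exists (fun P => Ordinal (block_color_lt (vpick (val P)))) => L [c mono].
have [v vL /andP[v0]] := block_color_not_mono (val L) c (eqP (valP L)).
have dim_v : \dim <[v]>%VS == 1%N by rewrite dim_vline v0.
have /(congr1 val) /= <- := mono (Sub <[v]>%VS dim_v) vL.
(* The generator picked for the point of [v] is a nonzero multiple of [v], so it has the same
   color. *)
have /vlineP[a aE] : vpick <[v]> \in <[v]>%VS by exact: memv_pick.
rewrite aE block_colorZ ?eqxx //; apply: contra v0 => /eqP a0.
move/eqP: aE; rewrite a0 scale0r vpick0 -dimv_eq0 dim_vline.
by case: (v == 0).
Qed.

End BlockColoring.

(** * The numerical bounds *)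

Lemma pg_chi_le (F : finFieldType) (n k : nat) :
  pg_colorable F n k -> (pg_chi F n <= k)%N.
Proof.
by move=> ck; rewrite /pg_chi; case: ex_minnP => m _; apply; apply/asboolP.
Qed.

Lemma pg_chi_le_blocks (F : finFieldType) (n d : nat) :
    (0 < n)%N -> (0 < d)%N -> (2 * d <= #|F|)%N ->
  (pg_chi F n <= d + n.-1 %/ d)%N.
Proof. by move=> n0 d0 dF; apply/pg_chi_le/pg_colorable_blocks. Qed.

Theorem theorem1p4 (R : rcfType) (p e q : nat) (hp : prime p) (he : (0 < e)%N)
    (hq : q = (p ^ e)%N) (F : finFieldType) (hF : #|F| = q)
    (n : nat) (hn : (2 <= n)%N) :
  (pg_chi F n)%:R < 2 * n%:R / (q%:R - 1) + q%:R :> R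
  /\ (n%:R <= (q%:R / 2) * (q%:R / 2 - 1) / 2 :> R ->
      (pg_chi F n)%:R <= Num.sqrt (8 * n%:R) + 4 :> R).
Proof.
have n0 : (0 < n)%N by lia.
have q2 : (2 <= q)%N by rewrite -hF; exact: finalg.card_finNzRing_gt1.
have qR : 2 <= q%:R :> R by rewrite ler_nat.
split.
  have h0 : (0 < q./2)%N by lia.
  have := pg_chi_le_blocks F n q./2 n0 h0 ltac:(lia).
  set c := pg_chi F n; set m := (n.-1 %/ _)%N => cm.
  have mq : (m * (q - 1) < 2 * n)%N.
    have : (m * q./2 <= n.-1)%N by exact: leq_divM.
    (* The term q - 1 absorbs the rounding in [q./2] when q is odd. *)
    have : (m * (q - 1) <= m * (2 * q./2))%N by rewrite leq_mul2l; lia.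
    lia.
  have mR : m%:R < 2 * n%:R / (q%:R - 1) :> R.
    rewrite ltr_pdivlMr; last by lra.
    by rewrite -[1]/(1%:R) -natrB ?(ltnW q2) // -!natrM ltr_nat.
  have : c%:R <= q%:R + m%:R :> R by rewrite -natrD ler_nat; lia.
  lra.
move=> nq.
have nq' : (8 * n + 2 * q <= q * q)%N.
  rewrite -(ler_nat R) natrD !natrM; lra.
(* The least such [d] is the square root of n rounded up. *)
have ex_d : exists d, (n <= d * d)%N by exists n; nia.
case: (ex_minnP ex_d) => d dn dmin.
have d0 : (0 < d)%N by case: d dn {dmin} => //; lia.
have dq : (2 * d <= q)%N.
  have : (d <= q./2)%N by apply: dmin; have := odd_double_half q; nia.
  lia.
have d1 : ((d - 1) * (d - 1) < n)%N.
  by rewrite ltnNge; apply/negP => /dmin; lia.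
have := pg_chi_le_blocks F n d n0 d0 ltac:(by rewrite hF).
have : (n.-1 %/ d < d)%N by rewrite ltn_divLR //; lia.
set c := pg_chi F n; set m := (n.-1 %/ _)%N => md cm.
(* Minimality of [d] gave (d - 1)^2 < n, hence 4(d - 1)^2 <= 8n. *)
have sqrt_ge : (2 * (d - 1))%:R <= Num.sqrt (8 * n%:R) :> R.
  rewrite -[leLHS]ger0_norm // -sqrtr_sqr ler_sqrt ?mulr_ge0 //.
  by rewrite -natrX -natrM ler_nat; nia.
have : c%:R <= (2 * (d - 1))%:R + 4 :> R.
  by rewrite -[4]/(4%:R) -natrD ler_nat; lia.
lra.
Qed.
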